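(* Let $s\geq 1$ and let $m(n)$ and $a_i(n)$ ($1\leq i\leq s$) be integer-valued polynomials in $n$ with positive leading coefficients. Suppose that $A(n)=(a_1(n),\dots,a_s(n))$ is strongly coprime. Then $$p_{A(n)}(m(n))=\#\{(x_1,\dots,x_s)\in\mathbb{Z}^s : x_j\geq 0 \text{ for all } j,\ x_1a_1(n)+\cdots+x_sa_s(n)=m(n)\}$$ is an integer-valued quasi-polynomial in $n$ for $n$ sufficiently large; that is, there exist an integer-valued quasi-polynomial $f$ and an integer $N_0$ such that $p_{A(n)}(m(n))=f(n)$ for all integers $n\geq N_0$.
   Context: $\mathbb{N}$ denotes the nonnegative integers. An integer-valued polynomial in $n$ is a polynomial with rational coefficients taking integer values at all integers. Integer-valued quasi-polynomials. A function $f:\mathbb{N}\to\mathbb{Z}$ is an integer-valued quasi-polynomial if there are a positive integer $T$ and polynomials $f_0,\dots,f_{T-1}\in\mathbb{Z}[x]$ such that $f(Tm+i)=f_i(m)$ for all $m\in\mathbb{N}$ and $0\leq i\leq T-1$. One then writes $f=(T,\{f_i\}_{i=0}^{T-1})$; the degree is $\max_i \deg f_i$ and $T$ is a period. Let $R$ be the ring of all such functions under pointwise operations. (Integer-valued polynomials give elements of $R$.) Order. For $r=(T,\{r_i\})\in R$, write $r\succcurlyeq 0$ if each $r_i$ is $0$ or has positive leading coefficient, and $r\succ 0$ if each $r_i$ has positive leading coefficient; write $f\preccurlyeq g$ if $g-f\succcurlyeq 0$ and $f\prec g$ if $g-f\succ 0$. For $g\in\mathbb{Z}[x]$, $|g|$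 is $g$, $-g$ or $0$ according as $g\succ0$, $g\prec 0$ or $g=0$. Remainder. For $f,g\in\mathbb{Z}[x]$ with $g\neq 0$ there are unique $P,r\in R$ with $f=Pg+r$ and $0\preccurlyeq r\prec |g|$; put $\mathrm{rem}(f,g)=r$. For $f,g\in R$ with least common period $T$, $f=(T,\{f_i\})$, $g=(T,\{g_i\})$, define $\mathrm{rem}(f,g)\in R$ by: at $n=Tm+i$ its value is $\mathrm{rem}(f_i,g_i)(m)$ if $g_i\neq 0$ (as a polynomial) and $f_i(m)$ if $g_i=0$. Coprimality. Elements $f,g\in R$ are coprime if their generalized greatest common divisor in $R$ is $1$, i.e. $\gcd(f(n),g(n))=1$ for every $n\in\mathbb{N}$. A vector with entries in $R$ is pairwise coprime if its entries are pairwise coprime. A vector with entries in $R$ is constant if every nonzero entry has degree $0$. Strongly coprime. For $A(n)=(a_1(n),\dots,a_s(n))$, let $A^{(0)}(n)=\{A(n)\}$. For $k\geq 0$ and indices $i_1,\dots,i_{k+1}\in\{1,\dots,s\}$ define recursively, for $i\in\{1,\dots,s\}$, $$a_{i_1\cdots i_ki_{k+1}i}(n)=\begin{cases}\mathrm{rem}\big(a_{i_1\cdots i_k i}(n),\,a_{i_1\cdots i_ki_{k+1}}(n)\big), & i\neq i_{k+1},\\ a_{i_1\cdots i_ki_{k+1}}(n), & i=i_{k+1},\end{cases}$$ $$A_{i_1\cdots i_{k+1}}(n)=\big(a_{i_1\cdots i_{k+1}1}(n),\dots,a_{i_1\cdots i_{k+1}s}(n)\big),$$ and, if $A^{(k)}(n)$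 is nonempty, $$A^{(k+1)}(n)=\{A_{i_1\cdots i_{k+1}}(n) : i_1,\dots,i_{k+1}\in\{1,\dots,s\},\ A_{i_1\cdots i_{k+1}}(n)\text{ is not constant}\};$$ if $A^{(k)}(n)$ is empty, then $A^{(l)}(n)$ is empty for all $l>k$. The vector $A(n)$ is strongly coprime if, for every $k\geq 0$, every vector in $A^{(k)}(n)$ is pairwise coprime. *)

(* Defs.v *)
From HB Require Import structures.
From mathcomp Require Import all_boot all_order all_algebra.
From mathcomp Require Import boolp classical_sets functions cardinality.

Set Implicit Arguments.
Unset Strict Implicit.
Unset Printing Implicit Defensive.

Import Order.TTheory GRing.Theory Num.Theory.
Local Open Scope ring_scope.
Local Open Scope classical_set_scope.

(* Elements of the ring R are plain functions [nat -> int] satisfying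
   [quasi_poly]; the ring operations are written pointwise. *)

Definition represents (f : nat -> int) (T : nat) (fs : 'I_T -> {poly int})
    : Prop :=
  (0 < T)%N /\ forall (m : nat) (i : 'I_T), f (T * m + i)%N = (fs i).[m%:Z].

Definition period (f : nat -> int) (T : nat) : Prop :=
  exists fs : 'I_T -> {poly int}, represents f fs.

Definition quasi_poly (f : nat -> int) : Prop := exists T : nat, period f T.

(* The degree of the zero polynomial is counted as 0; this affects only the
   zero function. *)
Definition has_degree (f : nat -> int) (d : nat) : Prop :=
  exists (T : nat) (fs : 'I_T -> {poly int}),
    represents f fs /\ (\max_(i < T) (size (fs i)).-1 = d)%N.

(* The sign conditions below do not depend on the representation: refining the
   period replaces each constituent p by polynomials p.[k x + j] with 0 < k,
   whose leading coefficients have the sign of that of p. *)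
Definition qge0 (r : nat -> int) : Prop :=
  exists (T : nat) (rs : 'I_T -> {poly int}),
    represents r rs /\ forall i : 'I_T, rs i = 0 \/ 0 < lead_coef (rs i).

Definition qgt0 (r : nat -> int) : Prop :=
  exists (T : nat) (rs : 'I_T -> {poly int}),
    represents r rs /\ forall i : 'I_T, 0 < lead_coef (rs i).

Definition qlt (f g : nat -> int) : Prop := qgt0 (fun n => g n - f n).

Definition poly_fun (p : {poly int}) : nat -> int := fun n => p.[n%:Z].

Definition poly_abs (g : {poly int}) : {poly int} :=
  if 0 < lead_coef g then g else if lead_coef g < 0 then - g else 0.

Definition is_poly_rem (f g : {poly int}) (r : nat -> int) : Prop :=
  exists P : nat -> int,
    [/\ quasi_poly P, quasi_poly r,
        forall n, poly_fun f n = P n * poly_fun g n + r n,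
        qge0 r & qlt r (poly_fun (poly_abs g))].

(* [xget x0 S] is an element of S if there is one, and x0 otherwise. When g is
   nonzero there is exactly one r with [is_poly_rem f g r]. *)
Definition poly_rem (f g : {poly int}) : nat -> int :=
  xget (fun=> 0) [set r | is_poly_rem f g r].

Definition least_common_period (f g : nat -> int) : nat :=
  xget 1%N [set T | [/\ period f T, period g T &
    forall T', period f T' -> period g T' -> (T <= T')%N]].

(* The constituent f_i of f for the period T (unique, as an integer polynomial
   is determined by its values on the naturals). *)
Definition constituent (f : nat -> int) (T i : nat) : {poly int} :=
  xget 0 [set p : {poly int} | forall m : nat, f (T * m + i)%N = p.[m%:Z]].

Definition qrem (f g : nat -> int) : nat -> int := fun n =>
  let T := least_common_period f g in
  let m := (n %/ T)%N in
  let fi := constituent f T (n %% T) in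
  let gi := constituent g T (n %% T) in
  if gi != 0 then poly_rem fi gi m else fi.[m%:Z].

Definition qcoprime (f g : nat -> int) : Prop :=
  forall n : nat, gcdz (f n) (g n) = 1.

Section Vectors.
Variable s : nat.
Implicit Types A : 'I_s -> nat -> int.

Definition pairwise_qcoprime A : Prop :=
  forall i j : 'I_s, i != j -> qcoprime (A i) (A j).

Definition constant_vec A : Prop :=
  forall i : 'I_s, A i <> (fun=> 0) -> has_degree (A i) 0.

Definition rem_step A (j : 'I_s) : 'I_s -> nat -> int :=
  fun i => if i == j then A j else qrem (A i) (A j).

(* For w = [:: i_1; ...; i_k], this is the vector A_{i_1 ... i_k}. *)
Definition iter_rem A (w : seq 'I_s) : 'I_s -> nat -> int :=
  foldl rem_step A w.

(* The set A^(k). *)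
Fixpoint rem_level A (k : nat) : set ('I_s -> nat -> int) :=
  if k is k'.+1 then
    [set B | rem_level A k' !=set0 /\
      exists w : k.-tuple 'I_s, B = iter_rem A w /\ ~ constant_vec B]
  else [set A].

Definition strongly_coprime A : Prop :=
  forall (k : nat) (B : 'I_s -> nat -> int),
    rem_level A k B -> pairwise_qcoprime B.

End Vectors.

Definition integer_valued (p : {poly rat}) : Prop :=
  forall z : int, p.[z%:~R] \is a Num.int.

(* The function n |-> p(n), with values in int; the floor is exact when p is
   integer-valued. *)
Definition int_fun (p : {poly rat}) : nat -> int :=
  fun n => Num.floor p.[n%:R].

Definition denumerant_sols (s : nat) (a : 'I_s -> int) (m : int)
    : set 'rV[int]_s :=
  [set x | (forall j, 0 <= x 0 j) /\ \sum_(j < s) x 0 j * a j = m].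

(* p_a(m) = N; in particular the set of solutions is finite. *)
Definition denumerant_eq (s : nat) (a : 'I_s -> int) (m : int) (N : int)
    : Prop :=
  exists k : nat, (denumerant_sols a m #= `I_k)%card /\ N = k%:Z.

(* Main.v *)
From mathcomp Require Import all_boot all_order all_algebra.
From mathcomp Require Import boolp classical_sets cardinality.
From mathcomp Require Import zify ring.
Require Import Defs.

Set Implicit Arguments.
Unset Strict Implicit.
Unset Printing Implicit Defensive.

Import Order.TTheory GRing.Theory Num.Theory.
Local Open Scope ring_scope.

(** For large [n] every solution [x] has [x_i < n^D], so [x_i] can be written
   with [D] digits [y_ij < n] in base [n].  After clearing denominators,
   [a_i], [m] have integer coefficients, and the equation says that [n] is a
   root of [m - \sum y_ij X^j a_i], that is, this polynomial equals
   [C * (X - n)]; the coefficients of [C] (the carries) are bounded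
   independently of [n].  For each of the finitely many [C], we count the
   [y_ij < n] satisfying a linear system with constant coefficients whose
   right-hand side is affine in [n].  Such counts are partition functions of
   vectors with positive grade; Elliott's reduction eliminates the equations one
   at a time, until only a partition function with constant integer parts is
   left.  That function is annihilated by a product of difference operators
   [f(n+T) - f(n)], hence is an eventual quasi-polynomial. *)

(** * Sequences annihilated by difference operators *)

Definition diff (T : nat) (f : nat -> int) : nat -> int :=
  fun t => f (t + T)%N - f t.

Definition ev0 (f : nat -> int) : Prop :=
  exists N : nat, forall t, (N <= t)%N -> f t = 0.

(** These are the eventual quasi-polynomials. In this form, closure under sums and under inverting a
    difference operator is mere operator algebra over the integers. *)
Definition eqp (f : nat -> int) : Prop :=
  exists T k : nat, (0 < T)%N /\ ev0 (iter k (diff T) f).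

Lemma diffC d T f : diff d (diff T f) = diff T (diff d f).
Proof. by apply: funext => t; rewrite /diff -!addnA (addnC d T); ring. Qed.

Lemma iter_diffC k d T f : iter k (diff T) (diff d f) = diff d (iter k (diff T) f).
Proof. by elim: k => //= k ->; rewrite diffC. Qed.

Lemma diffD T f g : diff T (fun t => f t + g t) = (fun t => diff T f t + diff T g t).
Proof. by apply: funext => t; rewrite /diff; ring. Qed.

Lemma iter_diffD k T f g :
  iter k (diff T) (fun t => f t + g t) =
  (fun t => iter k (diff T) f t + iter k (diff T) g t).
Proof. by elim: k => //= k ->; rewrite diffD. Qed.

(** With $E$ the shift by 1, $E^{qd}-1$ is a multiple of $E^d-1$; hence a period may be replaced by
    any multiple of it. *)
Lemma diff_mul q d f t : diff (q * d) f t = \sum_(i < q) diff d f (t + i * d)%N.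
Proof.
elim: q => [|q IH]; first by rewrite big_ord0 /diff addn0 subrr.
rewrite big_ord_recr /= -IH /diff mulSn (addnC d) addnA; ring.
Qed.

Lemma ev0_diff_mul q d f : ev0 (diff d f) -> ev0 (diff (q * d) f).
Proof.
move=> [N hN]; exists N => t ht; rewrite diff_mul big1 // => i _.
by apply: hN; rewrite (leq_trans ht) ?leq_addr.
Qed.

Lemma ev0_diff d f : ev0 f -> ev0 (diff d f).
Proof.
by move=> [N hN]; exists N => t ht; rewrite /diff !hN ?subrr // (leq_trans ht) ?leq_addr.
Qed.

Lemma ev0_iter_mul q k T f :
  ev0 (iter k (diff T) f) -> ev0 (iter k (diff (q * T)) f).
Proof.
elim: k f => //= k IH f /(ev0_diff_mul q); rewrite -iter_diffC => /IH.
by rewrite iter_diffC.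
Qed.

Lemma ev0_iter_leq k k' T f :
  (k <= k')%N -> ev0 (iter k (diff T) f) -> ev0 (iter k' (diff T) f).
Proof.
move=> /subnK <- h; rewrite iterD; elim: (k' - k)%N => //= j.
exact: ev0_diff.
Qed.

Lemma ev0_eqp f : ev0 f -> eqp f.
Proof. by exists 1%N, 0%N. Qed.

Lemma eq_eqp f g N : (forall t, (N <= t)%N -> f t = g t) -> eqp f -> eqp g.
Proof.
move=> fg [T [k [T0 [N' h]]]]; exists T, k; split=> //.
suff e t : (N <= t)%N -> iter k (diff T) f t = iter k (diff T) g t.
  exists (maxn N N') => t; rewrite geq_max => /andP[h1 h2].
  by rewrite -e // h.
elim: k t {h} => /= [|k IH] t ht; first exact: fg.
by rewrite /diff !IH // (leq_trans ht) ?leq_addr.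
Qed.

Lemma eqpD f g : eqp f -> eqp g -> eqp (fun t => f t + g t).
Proof.
move=> [T [k [T0 hf]]] [T' [k' [T'0 hg]]].
exists (T' * T)%N, (maxn k k'); split; first by rewrite muln_gt0 T0 T'0.
rewrite iter_diffD.
have [N hN] := ev0_iter_leq (leq_maxl k k') (ev0_iter_mul T' hf).
have [N' hN'] := ev0_iter_leq (leq_maxr k k') (ev0_iter_mul T hg).
exists (maxn N N') => t; rewrite geq_max => /andP[h1 h2].
by rewrite hN // mulnC hN'.
Qed.

Lemma eqp_sum (I : Type) (r : seq I) (f : I -> nat -> int) :
  (forall i, eqp (f i)) -> eqp (fun t => \sum_(i <- r) f i t).
Proof.
move=> h; elim: r => [|i r IH].
  by apply: ev0_eqp; exists 0%N => t _; rewrite big_nil.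
apply: (@eq_eqp (fun t => f i t + \sum_(i <- r) f i t) _ 0).
  by move=> t _; rewrite big_cons.
exact: eqpD.
Qed.

Lemma eqpN f : eqp f -> eqp (fun t => - f t).
Proof.
move=> [T [k [T0 [N h]]]]; exists T, k; split=> //; exists N.
suff -> : iter k (diff T) (fun t => - f t) = (fun t => - iter k (diff T) f t).
  by move=> t ht; rewrite h ?oppr0.
by elim: k {h} => //= k ->; apply: funext => t; rewrite /diff; ring.
Qed.

(** For the common period [T * d], inverting the operator of step [d] costs one more factor, so the
    order grows from [k] to [k.+1]. *)
Lemma eqp_diff d f : (0 < d)%N -> eqp (diff d f) -> eqp f.
Proof.
move=> d0 [T [k [T0 h]]]; exists (T * d)%N, k.+1.
split; first by rewrite muln_gt0 T0.
rewrite iterS; apply: ev0_diff_mul; rewrite -iter_diffC mulnC.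
exact: ev0_iter_mul.
Qed.

Lemma eqp_affine a c f : (0 < a)%N -> eqp f -> eqp (fun t => f (a * t + c)%N).
Proof.
move=> a0 [T [k [T0 /(ev0_iter_mul a) [N h]]]]; exists T, k; split=> //.
suff -> : iter k (diff T) (fun t => f (a * t + c)%N) =
          (fun t => iter k (diff (a * T)) f (a * t + c)%N).
  exists N => t ht; apply: h; rewrite (leq_trans ht) //.
  by rewrite (leq_trans _ (leq_addr _ _)) // leq_pmull.
elim: k {h} => //= k ->; apply: funext => t; rewrite /diff mulnDr.
by rewrite addnAC.
Qed.

(** Expand $(1+\Delta_T)^m$, where the powers of $\Delta_T$ from [k] on vanish; the induction on [m]
    is Pascal's rule. *)
Lemma newton_forward k T f t m :
  (forall u, (t <= u)%N -> iter k (diff T) f u = 0) ->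
  f (t + m * T)%N = \sum_(j < k) 'C(m, j)%:Z * iter j (diff T) f t.
Proof.
elim: m t => [|m IH] t h.
  case: k h => [|k] h; first by rewrite big_ord0 mul0n addn0; exact: (h t).
  rewrite big_ord_recl big1 ?addn0 ?mul0n ?addr0 ?addn0 ?mul1r // => i _.
  by rewrite bin0n mul0r.
rewrite mulSn addnA IH; last by move=> u hu; rewrite h // (leq_trans _ hu) ?leq_addr.
have e j : iter j (diff T) f (t + T)%N = iter j (diff T) f t + iter j.+1 (diff T) f t.
  by rewrite iterS /diff; ring.
under eq_bigr => j _ do rewrite e mulrDr.
rewrite big_split /=.
case: k h {IH} => [|k] h; first by rewrite !big_ord0.
rewrite big_ord_recl [X in _ + X]big_ord_recr /= -/(iter k.+1 _ _).
rewrite (h t) // mulr0 addr0 [in RHS]big_ord_recl /= !bin0 -addrA; congr (_ + _).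
rewrite -big_split /=; apply: eq_bigr => i _.
by rewrite /bump /= add1n binS PoszD; ring.
Qed.

(** This is $\binom{Lx}{j}$. The factor $Lx$ of the falling factorial provides an $L$ that absorbs
    $j!$ when $j!$ divides $L$, so the coefficients stay integers. *)
Definition bin_poly (L j : nat) : {poly int} :=
  if j is j'.+1 then (L %/ j`!)%:Z *: ('X * \prod_(1 <= i < j) (L%:Z *: 'X - i%:Z%:P))
  else 1.

Lemma bin_polyE k j m : (j <= k)%N -> (bin_poly k`! j).[m%:Z] = 'C(k`! * m, j)%:Z.
Proof.
move=> jk; case: j jk => [|j] jk; first by rewrite hornerC bin0.
have fj : ((j.+1)`!%:Z : int) != 0 by rewrite eqz_nat -lt0n fact_gt0.
apply: (mulIf fj); rewrite -[RHS]PoszM bin_ffact ffact_prod.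
set L := k`!.
have Ld : (L = L %/ (j.+1)`! * (j.+1)`!)%N.
  by rewrite divnK // /L -(bin_fact jk) dvdn_mull // dvdn_mulr.
rewrite /bin_poly hornerZ hornerM hornerX horner_prod.
have -> : ((L %/ (j.+1)`!)%:Z *
    (m%:Z * \prod_(1 <= i < j.+1) (L%:Z *: 'X - i%:Z%:P).[m%:Z]) * (j.+1)`!)
  = \prod_(i < j.+1) ((L * m)%N%:Z - i%:Z).
  have Lz : L%:Z = (L %/ (j.+1)`!)%:Z * (j.+1)`!%:Z by rewrite -PoszM -Ld.
  rewrite big_ord_recl subr0 PoszM [X in _ = X * _ * _]Lz big_add1 /= big_mkord.
  have -> : \prod_(i < j) (L%:Z *: 'X - i.+1%:Z%:P).[m%:Z] =
            \prod_(i < j) (L%:Z * m%:Z - (bump 0 i)%:Z).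
    by apply: eq_bigr => i _; rewrite hornerD hornerN hornerZ hornerX hornerC.
  by ring.
(* Truncated and integer subtraction agree if [j < L * m]; otherwise the factor of index [L * m] is
   0 in both products. *)
have [hj|hj] := leqP j.+1 (L * m).
  rewrite (big_morph _ PoszM (erefl 1%:Z)); apply: eq_bigr => i _.
  by rewrite subzn // ltnW // (leq_trans (ltn_ord i)).
rewrite (bigD1 (Ordinal hj)) //= subrr mul0r.
by rewrite (bigD1 (Ordinal hj)) //= subnn mul0n.
Qed.

(* With [T * k`!] instead of [T] as period, the binomial coefficients of Newton's
   formula become polynomials with integer coefficients. *)
Lemma eqp_quasi_poly f : eqp f ->
  exists g N, quasi_poly g /\ forall n, (N <= n)%N -> f n = g n.
Proof.
move=> [T [k [T0 [N h]]]].
pose L := k`!; pose U := (T * L)%N.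
have U0 : (0 < U)%N by rewrite muln_gt0 T0 fact_gt0.
(* Newton's formula is based at [U * N + r], beyond [N], where the [k]-th difference vanishes; this
   explains the shift of ['X] by [N]. *)
pose P (r : nat) : {poly int} :=
  \sum_(j < k) iter j (diff T) f (U * N + r)%N *: (bin_poly L j \Po ('X - N%:Z%:P)).
exists (fun n => (P (n %% U)%N).[(n %/ U)%N%:Z]), (U * N)%N; split.
  exists U, (fun i => P i); split=> // m i.
  by rewrite (mulnC U) divnMDl // modnMDl modn_small // divn_small ?addn0.
move=> n hn; set q := (n %/ U)%N; set r := (n %% U)%N.
have Nq : (N <= q)%N by rewrite leq_divRL // mulnC.
have -> : n = ((U * N + r) + (L * (q - N)) * T)%N.
  by rewrite {1}(divn_eq n U) -/q -/r -{1}(subnK Nq) /U; nia.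
rewrite (@newton_forward k); last first.
  move=> u hu; apply: h; apply: leq_trans hu.
  by rewrite (leq_trans _ (leq_addr _ _)) // leq_pmull.
rewrite /P horner_sum; apply: eq_bigr => j _.
rewrite hornerZ horner_comp !hornerE subzn // bin_polyE; last exact: ltnW.
by rewrite mulrC.
Qed.

(** * Partition functions of vectors *)

Implicit Types (a b p q r u v : {poly int}) (F G : {poly int} -> int).
Implicit Types (V : seq {poly int}).

(* Integer vectors are encoded as polynomials.  The constant coefficient is the
   grade: it is positive on the vectors that are summed over, so that the sums
   below are finite. *)
Definition nneg_supp (F : {poly int} -> int) : Prop :=
  forall p : {poly int}, p`_0 < 0 -> F p = 0.

(** On generating functions this is division by $1-x^v$: if [F] vanishes on negative grades and [v]
    has positive grade, the truncation loses no term. Iterated over [V] and applied to [delta]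
    below, it gives the partition function of [V]. *)
Definition ray_sum (v : {poly int}) (F : {poly int} -> int) : {poly int} -> int :=
  fun p => \sum_(j < (absz (p`_0)%R).+1) F (p - v *+ j).

Definition cone_sum (V : seq {poly int}) F := foldr ray_sum F V.

Definition pos (V : seq {poly int}) := all (fun v : {poly int} => 0 < v`_0) V.

Lemma coefBMn p v (e j : nat) : (p - v *+ j)`_e = p`_e - v`_e * j%:Z.
Proof. by rewrite coefB coefMn -mulr_natr natz. Qed.

Lemma subn_lt0 (x y : int) (n : nat) : 0 <= y -> x < 0 -> x - y * n%:Z < 0.
Proof. by nia. Qed.

Lemma ray_sum_big v F p K : nneg_supp F -> 0 < v`_0 -> (absz (p`_0)%R < K)%N ->
  ray_sum v F p = \sum_(j < K) F (p - v *+ j).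
Proof.
move=> hF hv hK; rewrite /ray_sum (big_ord_widen K (fun j => F (p - v *+ j)) hK).
rewrite big_mkcond; apply: eq_bigr => j _; case: ltnP => // hj.
by rewrite hF // coefBMn; nia.
Qed.

Lemma ray_sum_supp v F : nneg_supp F -> 0 < v`_0 -> nneg_supp (ray_sum v F).
Proof.
move=> hF hv p hp; rewrite /ray_sum big1 // => j _; rewrite hF // coefBMn; nia.
Qed.

Lemma cone_sum_supp V F : nneg_supp F -> pos V -> nneg_supp (cone_sum V F).
Proof. by move=> hF; elim: V => //= v V IH /andP[hv /IH h]; apply: ray_sum_supp. Qed.

Lemma ray_sum_rec v F p : nneg_supp F -> 0 < v`_0 ->
  ray_sum v F p = F p + ray_sum v F (p - v).
Proof.
move=> hF hv.
pose K := (absz (p`_0)%R + absz ((p - v)`_0)%R)%N.+1.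
rewrite (@ray_sum_big _ _ p K.+1) ?(@ray_sum_big _ _ (p - v) K) //;
  try by rewrite /K; lia.
rewrite big_ord_recl mulr0n subr0; congr (_ + _); apply: eq_bigr => i _.
by rewrite lift0 mulrS opprD addrA.
Qed.

(** Each use of the recursion lowers the grade by at least 1, until the support condition forces the
    value 0. Identities between ray sums thus reduce to checking a recursion. *)
Lemma ray_sum_uniq v F G : nneg_supp G -> nneg_supp F -> 0 < v`_0 ->
  (forall p, F p = G p + F (p - v)) -> F = ray_sum v G.
Proof.
move=> hG hF hv h; apply: funext => p.
have [n] := ubnP (absz (p`_0)%R); elim: n p => // n IH p hp.
have [hn|hn] := ltrP p`_0 0; first by rewrite hF // ray_sum_supp.
rewrite h ray_sum_rec //; congr (_ + _).
have [hn'|hn'] := ltrP (p - v)`_0 0; first by rewrite hF // ray_sum_supp.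
apply: IH; move: hp hn hv hn'; rewrite coefB.
move: (p`_0) (v`_0) => x y; lia.
Qed.

Lemma ray_sum_comm u v F : nneg_supp F -> 0 < u`_0 -> 0 < v`_0 ->
  ray_sum u (ray_sum v F) = ray_sum v (ray_sum u F).
Proof.
move=> hF hu hv; apply: funext => p.
pose K := (absz (p`_0)%R).+1.
transitivity (\sum_(i < K) \sum_(j < K) F (p - u *+ i - v *+ j)).
  apply: eq_bigr => i _.
  (* The cutoff of a ray sum is an absolute value, which may exceed [K] when the grade is negative;
     there all terms are 0. *)
  have [hn|hn] := ltrP (p - u *+ i)`_0 0.
    rewrite ray_sum_supp // big1 // => j _; rewrite hF //.
    by rewrite coefBMn subn_lt0 // ltW.
  rewrite (@ray_sum_big _ _ _ K) //.
  by move: hn; rewrite /K coefBMn; nia.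
rewrite exchange_big; apply: eq_bigr => j _ /=; rewrite -/K.
have [hn|hn] := ltrP (p - v *+ j)`_0 0.
  rewrite ray_sum_supp // big1 // => i _; rewrite hF //.
  by rewrite addrAC coefBMn subn_lt0 // ltW.
rewrite (@ray_sum_big _ _ _ K) //; last first.
  by move: hn; rewrite /K coefBMn; nia.
by apply: eq_bigr => i _; congr F; rewrite addrAC.
Qed.

Lemma ray_cone_sumC v V F : nneg_supp F -> 0 < v`_0 -> pos V ->
  ray_sum v (cone_sum V F) = cone_sum V (ray_sum v F).
Proof.
move=> hF hv; elim: V => //= u V IH /andP[hu hV].
by rewrite ray_sum_comm ?IH //; apply: cone_sum_supp.
Qed.

Lemma ray_sum_shift v a F p : nneg_supp F -> 0 < v`_0 -> 0 <= a`_0 ->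
  ray_sum v (fun q => F (q - a)) p = ray_sum v F (p - a).
Proof.
move=> hF hv ha.
have hFa : nneg_supp (fun q => F (q - a)).
  by move=> q hq; rewrite hF // coefB subr_lt0 (lt_le_trans hq).
pose K := (absz (p`_0)%R + absz ((p - a)`_0)%R)%N.+1.
rewrite !(@ray_sum_big _ _ _ K) //; try by rewrite /K; lia.
by apply: eq_bigr => j _; rewrite addrAC.
Qed.

Lemma ray_sumD v F G p : ray_sum v (fun q => F q + G q) p = ray_sum v F p + ray_sum v G p.
Proof. by rewrite /ray_sum big_split. Qed.

(* On generating functions:
   [1/((1-x)(1-y)) = (1/(1-y) + x/(1-x)) / (1-xy)]. *)
Lemma ray_sum_elliott u v F p : nneg_supp F -> 0 < u`_0 -> 0 < v`_0 ->
  ray_sum u (ray_sum v F) p =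
    ray_sum (u + v) (ray_sum v F) p + ray_sum (u + v) (ray_sum u F) (p - u).
Proof.
move=> hF hu hv.
have huv : 0 < (u + v)`_0 by rewrite coefD addr_gt0.
have su : nneg_supp (ray_sum u F) by apply: ray_sum_supp.
have sv : nneg_supp (ray_sum v F) by apply: ray_sum_supp.
rewrite -[in X in _ + X]ray_sum_shift ?ltW // -ray_sumD; congr (_ p).
apply: ray_sum_uniq => //.
- by move=> q hq; rewrite sv // su ?addr0 // coefB subr_lt0 (lt_trans hq).
- exact: ray_sum_supp.
(* Peel off one [u], then one [v] from the double sum that remains. *)
move=> q; rewrite ray_sum_rec // ray_sum_comm //.
rewrite (ray_sum_rec (q - u)) // ray_sum_comm // addrA.
by rewrite opprD addrA.
Qed.

(** Split the multiplicity of [v] by its residue modulo [q]. This allows [v] to be replaced by a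
    multiple with a prescribed size of one coordinate. *)
Lemma ray_sum_residue (q : nat) v F p : (0 < q)%N -> nneg_supp F -> 0 < v`_0 ->
  ray_sum v F p = \sum_(i < q) ray_sum (v *+ q) F (p - v *+ i).
Proof.
move=> hq hF hv.
have hvq : 0 < (v *+ q)`_0 by rewrite coefMn -mulr_natr natz; nia.
have hFi (i : nat) : nneg_supp (fun r => F (r - v *+ i)).
  by move=> r hr; rewrite hF // coefBMn subn_lt0 // ltW.
transitivity (ray_sum (v *+ q) (fun r => \sum_(i < q) F (r - v *+ i)) p); last first.
  rewrite {1}/ray_sum exchange_big; apply: eq_bigr => i _.
  by rewrite -ray_sum_shift //= coefMn mulrn_wge0 // ltW.
congr (_ p); apply: ray_sum_uniq => //.
- by move=> r hr; rewrite big1 // => i _; apply: hFi.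
- exact: ray_sum_supp.
elim: q {hq hvq} => [|q IH] r; first by rewrite big_ord0 add0r subr0.
by rewrite big_ord_recr /= -addrA mulrSr opprD (addrA r) -ray_sum_rec // IH.
Qed.

(** * Elimination of equations by Elliott's reduction *)

Definition delta (e : nat) (p : {poly int}) : int := \prod_(l < e) (p`_l == 0)%:R.

Lemma delta_supp e : nneg_supp (delta e.+1).
Proof.
by move=> p hp; rewrite /delta big_ord_recl /= (negbTE (ltr0_neq0 hp)) mul0r.
Qed.

Definition eqp_ray (F : {poly int} -> int) : Prop :=
  forall b, eqp (fun n => F (b + n%:Z%:P)).

Lemma eqp_ray_shift F a : eqp_ray F -> eqp_ray (fun p => F (p - a)).
Proof.
by move=> h b; apply: (@eq_eqp _ _ 0) (h (b - a)) => t _; rewrite addrAC.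
Qed.

Definition grade_only F := forall p q, p`_0 = q`_0 -> F p = F q.

Lemma ray_sum_grade_only v F : grade_only F -> grade_only (ray_sum v F).
Proof.
move=> h p q pq; rewrite /ray_sum pq; apply: eq_bigr => j _; apply: h.
by rewrite !coefB pq.
Qed.

Lemma delta1_grade_only : grade_only (delta 1).
Proof. by move=> p q pq; rewrite /delta !big_ord1 pq. Qed.

Lemma cone_sum_grade_only V F : grade_only F -> grade_only (cone_sum V F).
Proof. by move=> h; elim: V => //= v V; apply: ray_sum_grade_only. Qed.

(** If only the grade matters, subtracting [v] means going back by its grade along the ray. So the
    difference operator of that step removes [v] from the list, and the empty list leaves a finitely
    supported function. *)
Lemma eqp_ray_grade V : pos V -> eqp_ray (cone_sum V (delta 1)).
Proof.
elim: V => [_ b|v V IH /andP[hv hV] b].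
  apply: ev0_eqp; exists (absz (b`_0)%R).+1 => t ht.
  rewrite /cone_sum /= /delta big_ord1 coefD coefC /=.
  by case: eqP => // /eqP; rewrite addr_eq0 => /eqP h; move: ht; rewrite h abszN ltnn.
apply: (@eqp_diff (absz (v`_0)%R)); first by lia.
apply: (@eq_eqp _ _ 0) (IH hV (b + (absz (v`_0)%R)%:Z%:P)) => t _ /=.
have hF : nneg_supp (cone_sum V (delta 1)).
  by apply: cone_sum_supp => //; apply: delta_supp.
rewrite /diff (ray_sum_rec (b + (t + _)%N%:Z%:P)) // PoszD rmorphD /=.
set d := (X in _ + (_ + X)).
have hd : d`_0 = v`_0 by rewrite coefC /= gtz0_abs.
rewrite (@ray_sum_grade_only v _
  (@cone_sum_grade_only V _ delta1_grade_only) (_ - v) (b + t%:Z%:P)).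
  by rewrite addrK; congr (cone_sum V _ _); rewrite -addrA; congr (_ + _); rewrite addrC.
by rewrite coefB !coefD hd; ring.
Qed.

Definition coordeq (e : nat) (c : int) V := all (fun v : {poly int} => v`_e == c) V.

Lemma deltaSr e p : delta e.+1 p = delta e p * (p`_e == 0)%:R.
Proof. exact: big_ord_recr. Qed.

Lemma cone_sum_mulr V F (g : {poly int} -> int) p :
  (forall v p, v \in V -> g (p - v) = g p) ->
  cone_sum V (fun p => F p * g p) p = cone_sum V F p * g p.
Proof.
elim: V p => //= v V IH p h.
have hgV : forall u p, u \in V -> g (p - u) = g p.
  by move=> u q uV; apply: h; rewrite inE uV orbT.
rewrite /ray_sum mulr_suml; apply: eq_bigr => j _; rewrite IH //; congr (_ * _).
elim: (j : nat) => [|i IHi]; first by rewrite mulr0n subr0.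
by rewrite mulrSr opprD addrA h // mem_head.
Qed.

Lemma cone_sum_delta_coord0 e V : coordeq e 0 V ->
  cone_sum V (delta e.+1) = (fun p => cone_sum V (delta e) p * (p`_e == 0)%:R).
Proof.
move=> hV; apply: funext => p.
rewrite -(@cone_sum_mulr _ _ (fun q => (q`_e == 0)%:R)).
  by congr (cone_sum V _ p); apply: funext => q; rewrite deltaSr.
by move=> v q /(allP hV) /eqP ve; rewrite coefB ve subr0.
Qed.

(** Neither the vectors of [V] nor, as [0 < e], the steps along the ray change coordinate [e]: its
    equation holds for all [n] or for none. *)
Lemma eqp_ray_coord0 e V : (0 < e)%N -> coordeq e 0 V ->
  eqp_ray (cone_sum V (delta e)) -> eqp_ray (cone_sum V (delta e.+1)).
Proof.
move=> he hV h b; rewrite cone_sum_delta_coord0 //.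
have ce n : (b + n%:Z%:P)`_e = b`_e by rewrite coefD coefC gtn_eqF // addr0.
have [b0|b0] := eqVneq (b`_e) 0.
  by apply: (@eq_eqp _ _ 0) (h b) => t _; rewrite ce b0 eqxx mulr1.
by apply: ev0_eqp; exists 0%N => t _; rewrite ce (negbTE b0) mulr0.
Qed.

Definition halfsupp (e : nat) (c : int) F := forall p, p`_e * c < 0 -> F p = 0.

Lemma halfsupp_ray_sum e c v F : v`_e = c -> halfsupp e c F -> halfsupp e c (ray_sum v F).
Proof.
move=> ve hF p hp; rewrite /ray_sum big1 // => j _; apply: hF.
rewrite coefBMn ve mulrBl mulrAC subn_lt0 //; exact: sqr_ge0.
Qed.

(* Only finitely many multiples of [v], independently of [n], can be subtracted
   before coordinate [e] has the wrong sign. *)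
Lemma eqp_ray_halfsupp e c v F : (0 < e)%N -> c != 0 -> v`_e = c -> 0 < v`_0 ->
  nneg_supp F -> halfsupp e c F -> eqp_ray F -> eqp_ray (ray_sum v F).
Proof.
move=> he c0 ve hv sF hF rF b.
have ce n : (b + n%:Z%:P)`_e = b`_e by rewrite coefD coefC gtn_eqF // addr0.
apply: (@eq_eqp (fun n => \sum_(j < (absz (b`_e)%R).+1) F (b + n%:Z%:P - v *+ j)) _ 0).
  move=> n _; set p := b + _.
  pose K := (absz (p`_0)%R + absz (b`_e)%R)%N.+1.
  rewrite (@ray_sum_big _ _ _ K) //; last by rewrite /K ltnS leq_addr.
  have hK : ((absz (b`_e)%R).+1 <= K)%N by rewrite /K ltnS leq_addl.
  rewrite (big_ord_widen K (fun j => F (p - v *+ j)) hK) big_mkcond.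
  apply: eq_bigr => j _; case: ltnP => // hj; rewrite hF // coefBMn ve ce.
  move: hj c0; move: (b`_e) (j : nat) => x i; nia.
apply: eqp_sum => j; exact: (eqp_ray_shift (v *+ j)).
Qed.

Lemma eqp_ray_cone_sum_halfsupp e c V F : (0 < e)%N -> c != 0 -> coordeq e c V ->
  pos V -> nneg_supp F -> halfsupp e c F -> eqp_ray F -> eqp_ray (cone_sum V F).
Proof.
move=> he c0 hV pV sF hF rF.
suff [] : eqp_ray (cone_sum V F) /\ halfsupp e c (cone_sum V F) by [].
elim: V hV pV => //= v V IH /andP[/eqP ve hV] /andP[v0 pV].
have [h1 h2] := IH hV pV; split; last exact: halfsupp_ray_sum.
by apply: eqp_ray_halfsupp h2 h1 => //; apply: cone_sum_supp.
Qed.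

Lemma pos_addr u v : 0 < u`_0 -> 0 < v`_0 -> 0 < (u + v)`_0.
Proof. by move=> hu hv; rewrite coefD addr_gt0. Qed.

(** Elliott's identity for [p] in [P] and [q] in [Q] puts [p + q], whose coordinate [e] is 0, into
    [Z] and drops [p] or [q]; so [size P + size Q] decreases. Once [P] or [Q] is empty, all
    remaining nonzero coordinates have one sign and [eqp_ray_halfsupp] bounds the multiplicities. *)
Lemma eqp_ray_elliott e (c : int) P Q Z : (0 < e)%N -> c != 0 ->
  (forall V, pos V -> eqp_ray (cone_sum V (delta e))) ->
  coordeq e c P -> coordeq e (- c) Q -> coordeq e 0 Z ->
  pos P -> pos Q -> pos Z ->
  eqp_ray (cone_sum P (cone_sum Q (cone_sum Z (delta e.+1)))).
Proof.
move=> he c0 IHe.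
have sd : nneg_supp (delta e.+1) by apply: delta_supp.
have [n] := ubnP (size P + size Q); elim: n P Q Z => // n IH P Q Z.
have hZ c' W : coordeq e 0 W -> pos W -> halfsupp e c' (cone_sum W (delta e.+1)).
  move=> hW pW p hp; rewrite cone_sum_delta_coord0 //.
  by case: eqP hp => [->|_]; rewrite ?mul0r ?mulr0 ?ltxx.
case: P => [|p P]; case: Q => [|q Q]; move=> hn cP cQ cZ pP pQ pZ.
- by apply: eqp_ray_coord0 => //; apply: IHe.
- apply: (@eqp_ray_cone_sum_halfsupp e (- c) (q :: Q)); rewrite ?oppr_eq0 //.
  + exact: cone_sum_supp.
  + exact: hZ.
  + by apply: eqp_ray_coord0 => //; apply: IHe.
- apply: (@eqp_ray_cone_sum_halfsupp e c (p :: P) (cone_sum Z (delta e.+1))) => //.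
  + exact: cone_sum_supp.
  + exact: hZ.
  + by apply: eqp_ray_coord0 => //; apply: IHe.
move: cP cQ pP pQ => /= /andP[/eqP cp cP] /andP[/eqP cq cQ] /andP[pp pP] /andP[pq pQ].
have sZ : nneg_supp (cone_sum Z (delta e.+1)) by apply: cone_sum_supp.
have sQ : nneg_supp (cone_sum Q (cone_sum Z (delta e.+1))) by apply: cone_sum_supp.
have sPQ : nneg_supp (cone_sum P (cone_sum Q (cone_sum Z (delta e.+1)))).
  by apply: cone_sum_supp.
have ppq := pos_addr pp pq.
have cpq : coordeq e 0 ((p + q) :: Z) by rewrite /= coefD cp cq subrr eqxx.
have ppqZ : pos ((p + q) :: Z) by rewrite /= ppq.
(* The ray sums commute, so [p] and [q] can be made adjacent and [p + q] moved next to [Z]. *)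
have -> : ray_sum p (cone_sum P (ray_sum q (cone_sum Q (cone_sum Z (delta e.+1))))) =
   (fun r => cone_sum P (cone_sum (q :: Q) (cone_sum ((p + q) :: Z) (delta e.+1))) r
           + cone_sum (p :: P) (cone_sum Q
               (cone_sum ((p + q) :: Z) (delta e.+1))) (r - p)).
  apply: funext => r; rewrite -ray_cone_sumC // ray_sum_elliott //=.
  have -> : cone_sum Q (ray_sum (p + q) (cone_sum Z (delta e.+1))) =
            ray_sum (p + q) (cone_sum Q (cone_sum Z (delta e.+1))).
    exact/esym/ray_cone_sumC.
  rewrite (ray_sum_comm _ pq ppq) // -(ray_cone_sumC _ ppq) //; last exact: ray_sum_supp.
  rewrite -(ray_cone_sumC sQ pq pP) -(ray_cone_sumC sQ ppq pP).
  by rewrite (ray_sum_comm sPQ pp ppq).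
move=> b; apply: eqpD.
  by apply: IH; rewrite //= ?cq ?eqxx ?pq //; move: hn => /=; lia.
apply: (eqp_ray_shift p); apply: IH; rewrite //= ?cp ?eqxx ?pp //; move: hn => /=; lia.
Qed.

Lemma common_multiple (e : nat) V :
  exists2 L : nat, (0 < L)%N & forall v, v \in V -> v`_e != 0 -> (absz (v`_e)%R %| L)%N.
Proof.
elim: V => [|v V [L L0 h]]; first by exists 1%N.
exists (L * (if (v`_e == 0)%R then 1 else absz (v`_e)%R))%N.
  by rewrite muln_gt0 L0 /=; case: eqP => // /eqP; rewrite absz_gt0.
move=> u; rewrite inE => /orP[/eqP -> /negbTE ->|uV u0]; first exact: dvdn_mull.
by rewrite dvdn_mulr // h.
Qed.

(** The vectors of [V] are distributed over [P], [Q] and [Z]; a nonzero coordinate [e] is first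
    brought to [L] or [- L] by splitting into residues. *)
Lemma eqp_ray_residue e (L : nat) V P Q Z : (0 < e)%N -> (0 < L)%N ->
  (forall V, pos V -> eqp_ray (cone_sum V (delta e))) ->
  (forall v, v \in V -> v`_e != 0 -> (absz (v`_e)%R %| L)%N) ->
  coordeq e L%:Z P -> coordeq e (- L%:Z) Q -> coordeq e 0 Z ->
  pos V -> pos P -> pos Q -> pos Z ->
  eqp_ray (cone_sum V (cone_sum P (cone_sum Q (cone_sum Z (delta e.+1))))).
Proof.
move=> e0 L0 IHe; elim: V P Q Z => [|v V IH] P Q Z hV cP cQ cZ pV pP pQ pZ.
  by apply: (@eqp_ray_elliott e L%:Z) => //; rewrite -lt0n.
have sd : nneg_supp (delta e.+1) by apply: delta_supp.
have sZ : nneg_supp (cone_sum Z (delta e.+1)) by apply: cone_sum_supp.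
have sQ : nneg_supp (cone_sum Q (cone_sum Z (delta e.+1))) by apply: cone_sum_supp.
have sP : nneg_supp (cone_sum P (cone_sum Q (cone_sum Z (delta e.+1)))).
  by apply: cone_sum_supp.
have hV' u : u \in V -> u`_e != 0 -> (absz (u`_e)%R %| L)%N.
  by move=> uV; apply: hV; rewrite inE uV orbT.
move: pV => /= /andP[pv pV].
have [v0|v0] := eqVneq (v`_e) 0.
  rewrite (ray_cone_sumC sP pv pV) (ray_cone_sumC sQ pv pP) (ray_cone_sumC sZ pv pQ).
  by apply: (IH P Q (v :: Z)) => //=; rewrite ?v0 ?eqxx ?pv.
have /dvdnP[q Lq] : (absz (v`_e)%R %| L)%N by apply: hV => //; apply: mem_head.
have q0 : (0 < q)%N by move: L0; rewrite Lq muln_gt0 => /andP[].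
have pvq : 0 < (v *+ q)`_0 by rewrite coefMn pmulrn_lgt0.
set F := cone_sum V _.
suff h : eqp_ray (ray_sum (v *+ q) F).
  move=> b; apply: (@eq_eqp (fun n => \sum_(i < q)
     ray_sum (v *+ q) F (b + n%:Z%:P - v *+ i)) _ 0).
    by move=> n _; rewrite [RHS](ray_sum_residue _ q0) //; apply: cone_sum_supp.
  by apply: eqp_sum => i; apply: (eqp_ray_shift (v *+ i)).
have : (v *+ q)`_e = L%:Z \/ (v *+ q)`_e = - L%:Z.
  by rewrite coefMn -mulr_natr natz Lq; lia.
rewrite /F (ray_cone_sumC sP pvq pV); case=> vq.
  by apply: (IH (v *+ q :: P) Q Z) => //=; rewrite ?vq ?eqxx ?pvq.
rewrite (ray_cone_sumC sQ pvq pP).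
by apply: (IH P (v *+ q :: Q) Z) => //=; rewrite ?vq ?eqxx ?pvq.
Qed.

Theorem eqp_ray_cone_sum e V : pos V -> eqp_ray (cone_sum V (delta e.+1)).
Proof.
elim: e V => [|e IH] V pV; first exact: eqp_ray_grade.
have [L L0 hL] := common_multiple e.+1 V.
exact: (@eqp_ray_residue e.+1 L V [::] [::] [::]).
Qed.

(** * Right-hand sides affine in the parameter *)

Lemma cons_polyBMn (c d : int) p v j :
  cons_poly c p - cons_poly d v *+ j = cons_poly (c - d * j%:Z) (p - v *+ j).
Proof.
apply/polyP => i; rewrite coefB coefMn !coef_cons.
by case: i => [|i] /=; rewrite ?coefB ?coefMn // -mulr_natr natz.
Qed.

Lemma delta_cons e (T : int) p : delta e.+1 (cons_poly T p) = (T == 0)%:R * delta e p.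
Proof.
rewrite /delta big_ord_recl /= coef_cons /=; congr (_ * _).
by apply: eq_bigr => i _; rewrite coef_cons.
Qed.

(** The new grade of each vector copies the old one, so the new equation either repeats the old
    grade equation or contradicts it. *)
Lemma cone_sum_cons e V (T : int) p :
  cone_sum [seq cons_poly v`_0 v | v : {poly int} <- V] (delta e.+2) (cons_poly T p) =
  if T == p`_0 then cone_sum V (delta e.+1) p else 0.
Proof.
elim: V T p => [|v V IH] T p /=.
  rewrite delta_cons /delta big_ord_recl /=.
  have [->|hT] := eqVneq T p`_0; first by case: eqP; rewrite ?mul1r ?mul0r.
  case: (eqVneq T 0) hT => [->|_ _]; rewrite ?mul0r //.
  by rewrite eq_sym => /negbTE ->; rewrite mul0r mulr0.
rewrite /ray_sum coef_cons /=; have [->|hT] := eqVneq T p`_0.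
  by apply: eq_bigr => j _; rewrite cons_polyBMn IH coefBMn eqxx.
rewrite big1 // => j _; rewrite cons_polyBMn IH coefBMn ifF //.
by apply/negbTE; rewrite (inj_eq (addIr _)).
Qed.

(* The parameter [n] becomes the multiplicity of the additional vector
   [cons_poly 1 (- c)]; the additional coordinate serves as the grade, and the
   old grade becomes an equation. *)
Theorem eqp_cone_sum_affine e V b (c : {poly int}) : pos V -> 0 <= b`_0 -> 0 <= c`_0 ->
  eqp (fun n => cone_sum V (delta e.+1) (b + c *+ n)).
Proof.
move=> pV b0 c0.
pose V' := [seq cons_poly v`_0 v | v : {poly int} <- V].
pose N : {poly int} := cons_poly 1 (- c).
have pV' : pos (N :: V').
  rewrite /= coef_cons /= /V'; elim: V pV {V'} => //= v V IH /andP[pv /IH ->].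
  by rewrite coef_cons /= pv.
have h : eqp (fun n => cone_sum (N :: V') (delta e.+2) (cons_poly b`_0 b + n%:Z%:P)).
  exact: eqp_ray_cone_sum.
(* If [N] is taken [j] times, the grade left is [T - j], and it must equal the old grade $b_0+c_0j$.
   For $T=b_0+(c_0+1)n$ this forces [j = n]. *)
apply: (@eq_eqp _ _ 0 _ (eqp_affine 0 (ltn0Sn (absz (c`_0)%R)) h)) => n _.
pose a := (absz (c`_0)%R).+1; rewrite addn0 -/a.
have az : a%:Z = c`_0 + 1 by rewrite /a -addn1 PoszD gez0_abs.
pose T := b`_0 + (a * n)%N%:Z.
have key (j : nat) : T - j%:Z = b`_0 + c`_0 * j%:Z -> j = n.
  move=> h'; have /eqP : a%:Z * (n%:Z - j%:Z) = 0.
    apply: (addrI (b`_0 + c`_0 * j%:Z + j%:Z)).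
    rewrite addr0 -[in RHS]h' /T PoszM az; ring.
  by rewrite mulf_eq0 eqz_nat /= subr_eq0 eqz_nat => /eqP.
have nT : (n < (absz T).+1)%N.
  have T0 : (n%:Z <= T) by rewrite -[n%:Z]add0r lerD // lez_nat leq_pmull.
  by rewrite ltnS -lez_nat gez0_abs // (le_trans _ T0).
have -> : cons_poly b`_0 b + (a * n)%N%:Z%:P = cons_poly T b.
  by rewrite !cons_poly_def -addrA -polyCD.
rewrite /= /ray_sum coef_cons /= (bigD1 (Ordinal nT)) //= big1 => [|j jn];
  rewrite cons_polyBMn mulNrn opprK mul1r cone_sum_cons coefD coefMn -mulr_natr natz.
  rewrite addr0 ifT // /T PoszM az; apply/eqP; ring.
rewrite ifF //; apply/negbTE; apply: contraNneq jn => /key jn.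
by apply/eqP/val_inj.
Qed.

(** * Bounded multiplicities *)

Section Box.
Variable M : zmodType.

(** The group [M] is arbitrary because the same sums occur for polynomials and for their integer
    values. *)
Definition box n (v : M) (F : M -> int) : M -> int :=
  fun x => \sum_(y < n) F (x - v *+ y).

Definition boxes n (W : seq M) (F : M -> int) : M -> int := foldr (box n) F W.

Lemma boxes_comm n (v : M) (W : seq M) (F : M -> int) :
  box n v (boxes n W F) = boxes n W (box n v F).
Proof.
elim: W => //= w W' <-; apply: funext => x; rewrite /box exchange_big.
by apply: eq_bigr => i _; apply: eq_bigr => j _; rewrite addrAC.
Qed.

Lemma boxes_shift n (W : seq M) (a : M) (F : M -> int) (p : M) :
  boxes n W (fun x => F (x - a)) p = boxes n W F (p - a).
Proof.
elim: W p => //= w W' IH p; rewrite /box.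
by apply: eq_bigr => i _; rewrite IH addrAC.
Qed.

Lemma boxes_sum n (W : seq M) (I : Type) (r : seq I) (F : I -> M -> int) (p : M) :
  boxes n W (fun x => \sum_(i <- r) F i x) p = \sum_(i <- r) boxes n W (F i) p.
Proof.
elim: W p => //= w W' IH p; rewrite /box exchange_big.
by apply: eq_bigr => i _; rewrite IH.
Qed.

Lemma boxesB n (W : seq M) (F G : M -> int) (p : M) :
  boxes n W (fun x => F x - G x) p = boxes n W F p - boxes n W G p.
Proof.
elim: W p => //= w W' IH p; rewrite /box -sumrB.
by apply: eq_bigr => i _; rewrite IH.
Qed.

End Box.

Implicit Types (W : seq {poly int}).

(** The finite geometric sum $(1-x^{nv})/(1-x^v)$. *)
Lemma box_ray_sum n v F p : nneg_supp F -> 0 < v`_0 ->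
  box n v F p = ray_sum v F p - ray_sum v F (p - v *+ n).
Proof.
move=> sF pv; rewrite /box; elim: n => [|n IH].
  by rewrite big_ord0 mulr0n subr0 subrr.
rewrite big_ord_recr /= IH (ray_sum_rec (p - v *+ n)) //.
rewrite mulrSr (opprD (v *+ n)) (addrA p); ring.
Qed.

(** Each [w] moves from the boxes to the cone, giving two terms with slopes [c] and [c - w]. As [w]
    has grade 1, the bound by [size W] keeps the grade of every slope nonnegative. *)
Lemma eqp_boxes_graded e W V b (c : {poly int}) :
  pos V -> all (fun w : {poly int} => w`_0 == 1) W ->
  0 <= b`_0 -> (size W)%:Z <= c`_0 ->
  eqp (fun n => boxes n W (cone_sum V (delta e.+1)) (b + c *+ n)).
Proof.
elim: W V c => [|w W IH] V c pV /=; first by move=> _; apply: eqp_cone_sum_affine.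
move=> /andP[/eqP w1 hW] b0 hc.
have sF : nneg_supp (cone_sum V (delta e.+1)).
  by apply: cone_sum_supp => //; apply: delta_supp.
have pw : 0 < w`_0 by rewrite w1.
have pwV : pos (w :: V) by rewrite /= pw.
have h1 : eqp (fun n => boxes n W (cone_sum (w :: V) (delta e.+1)) (b + c *+ n)).
  by apply: IH => //; apply: le_trans hc; rewrite lez_nat.
have h2 : eqp (fun n => boxes n W (cone_sum (w :: V) (delta e.+1)) (b + (c - w) *+ n)).
  by apply: IH => //; rewrite coefB w1 lerBrDr -PoszD addn1.
apply: (@eq_eqp _ _ 0) (eqpD h1 (eqpN h2)) => n _.
rewrite boxes_comm.
have -> : box n w (cone_sum V (delta e.+1)) =
    (fun p => cone_sum (w :: V) (delta e.+1) p -
              cone_sum (w :: V) (delta e.+1) (p - w *+ n)).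
  by apply: funext => p; rewrite box_ray_sum.
by rewrite boxesB boxes_shift mulrnBl addrA.
Qed.

(** The vectors of [W] use up a grade of at most [size W * n], so exactly one multiplicity of the
    slack vector fills the rest. *)
Lemma boxes_slack e n W (T : int) p : (size W * n)%N%:Z <= T ->
  boxes n [seq cons_poly 1 w | w <- W] (ray_sum 1 (delta e.+1)) (cons_poly T p) =
  boxes n W (delta e) p.
Proof.
elim: W T p => [|w W IH] T p /= hT.
  rewrite /ray_sum coef_cons /=.
  have e1 j : cons_poly T p - 1 *+ j = cons_poly (T - j%:Z) p.
    have -> : 1 = cons_poly 1 0 :> {poly int} by rewrite cons_poly_def mul0r add0r.
    by rewrite cons_polyBMn mul0rn subr0 mul1r.
  (* Only the last index, the absolute value of [T], leaves grade 0. *)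
  rewrite big_ord_recr /= big1 => [|j _]; rewrite e1 delta_cons.
    by rewrite gez0_abs // subrr eqxx mul1r add0r.
  rewrite (_ : (_ == _) = false) ?mul0r //; apply/negbTE.
  by have := ltn_ord j; rewrite subr_eq0; lia.
apply: eq_bigr => y _; rewrite cons_polyBMn IH // mul1r.
have := ltn_ord y; move: hT; rewrite mulSn; lia.
Qed.

(* A slack variable, with vector [1], makes the grade of the right-hand side
   equal to [size W * n]. *)
Theorem eqp_boxes e W b (c : {poly int}) :
  eqp (fun n => boxes n W (delta e) (b + c *+ n)).
Proof.
pose W' : seq {poly int} := [seq cons_poly 1 w | w <- W].
have h : eqp (fun n => boxes n W' (cone_sum [:: 1] (delta e.+1))
    (cons_poly 0 b + cons_poly (size W)%:Z c *+ n)).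
  apply: eqp_boxes_graded => //; rewrite ?coef_cons ?size_map //=.
    by rewrite coefC.
  by rewrite all_map; apply/allP => w _ /=; rewrite coef_cons.
apply: (eq_eqp (N := 0) _ h) => n _.
have -> : cons_poly 0 b + cons_poly (size W)%:Z c *+ n =
    cons_poly (size W * n)%N%:Z (b + c *+ n).
  apply/polyP => i; rewrite coefD coefMn !coef_cons.
  by case: i => [|i] /=; rewrite ?coefD ?coefMn // add0r PoszM -mulr_natr natz.
by rewrite boxes_slack.
Qed.

(** * Carries and digits *)

Lemma delta_eq0 e p : (size p <= e)%N -> delta e p = (p == 0)%:R.
Proof.
move=> hp; have [->|p0] := eqVneq p 0.
  by rewrite /delta big1 // => i _; rewrite coef0.
have hl : ((size p).-1 < e)%N by rewrite prednK // size_poly_gt0.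
rewrite /delta (bigD1 (Ordinal hl)) //=.
by rewrite -/(lead_coef p) lead_coef_eq0 (negbTE p0) mul0r.
Qed.

(** Let $p=q(X-n)$. Then $nq_{l+1}=q_l-p_{l+1}$, so inductively $|q_{l+1}|\leq 2K/n+K\leq 2K$ for
    $n\geq 2$. *)
Lemma quotient_coef_bound (n K : nat) q : (2 <= n)%N ->
  (forall l, `|(q * ('X - n%:Z%:P))`_l| <= (K * n)%N%:Z) ->
  forall l, `|q`_l| <= (2 * K)%N%:Z.
Proof.
move=> n2 h; elim=> [|l IH].
  move: (h 0%N); rewrite mulrBr coefB coefMX coefMC /=; move: (q`_0) => x; nia.
move: (h l.+1); rewrite mulrBr coefB coefMX coefMC /=.
move: IH; move: (q`_l) (q`_l.+1) => x y; nia.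
Qed.

(** Encoding by a finite type allows summation over all polynomials with at most [E] coefficients
    bounded by [K]; the values are shifted by [K] to be natural numbers. *)
Definition bounded_poly E (K : nat) (c : {ffun 'I_E -> 'I_(2 * K).+1}) : {poly int} :=
  rVpoly (\row_l ((c l)%:Z - K%:Z)).

Lemma size_bounded_poly E K (c : {ffun 'I_E -> 'I_(2 * K).+1}) :
  (size (bounded_poly c) <= E)%N.
Proof. exact: size_poly. Qed.

Lemma bounded_poly_inj E K : injective (@bounded_poly E K).
Proof.
move=> c d /(can_inj (@rVpolyK _ _)) /rowP h; apply/ffunP => l.
by have := h l; rewrite !mxE => /addIr [] /val_inj.
Qed.

Lemma bounded_poly_surj E (K : nat) q : (size q <= E)%N ->
  (forall l, `|q`_l| <= K%:Z) ->
  exists c : {ffun 'I_E -> 'I_(2 * K).+1}, bounded_poly c = q.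
Proof.
move=> sq hq; exists [ffun l : 'I_E => inord (absz (q`_l + K%:Z)%R)].
rewrite -[RHS](poly_rV_K sq); congr rVpoly; apply/rowP => l.
rewrite !mxE ffunE inordK; have := hq l; move: (q`_l) => x; lia.
Qed.

(* The coefficients of [bounded_poly c] are the carries. *)
Lemma root_carry (n E K : nat) p : (2 <= n)%N -> (size p <= E.+1)%N ->
  (forall l, `|p`_l| <= (K * n)%N%:Z) ->
  (p.[n%:Z] == 0)%:R = \sum_(c : {ffun 'I_E -> 'I_(2 * (2 * K)).+1})
     delta E.+1 (p - bounded_poly c * ('X - n%:Z%:P)).
Proof.
move=> n2 sp hp.
have dE (c : {ffun 'I_E -> 'I_(2 * (2 * K)).+1}) :
    delta E.+1 (p - bounded_poly c * ('X - n%:Z%:P)) =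
    (p == bounded_poly c * ('X - n%:Z%:P))%:R.
  rewrite delta_eq0 ?subr_eq0 // (leq_trans (size_polyD _ _)) // geq_max sp size_polyN.
  rewrite (leq_trans (size_polyMleq _ _)) // size_XsubC addn2 /= ltnS.
  exact: size_bounded_poly.
under eq_bigr => c _ do rewrite dE.
have [rp|rp] := boolP (root p n%:Z); last first.
  rewrite big1 => [|c _]; first by move: rp; rewrite rootE => /negbTE ->.
  case: eqP => // ep; case/negP: rp; rewrite ep; apply/rootP.
  by rewrite hornerM hornerXsubC subrr mulr0.
move: (rp) => /factor_theorem [q eq_p].
have sq : (size q <= E)%N.
  have [->|q0] := eqVneq q 0; first by rewrite size_poly0.
  by move: sp; rewrite eq_p size_Mmonic ?monicXsubC // size_XsubC addn2.
have [c hc] : exists c : {ffun 'I_E -> 'I_(2 * (2 * K)).+1}, bounded_poly c = q.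
  by apply: bounded_poly_surj sq _; apply: quotient_coef_bound n2 _; rewrite -eq_p.
rewrite (rootP rp) eqxx (bigD1 c) //= hc -eq_p eqxx big1 ?addr0 // => d dc.
case: eqP => // ep; case/negP: dc; apply/eqP/bounded_poly_inj.
apply: (@mulIf _ ('X - n%:Z%:P)); first by rewrite polyXsubC_eq0.
by rewrite hc -ep.
Qed.

Lemma coef_bounded p : exists K : nat, forall l, `|p`_l| <= K%:Z.
Proof.
exists (\sum_(i < size p) absz (p`_i)%R)%N => l.
have [hl|hl] := ltnP l (size p); last by rewrite nth_default.
by rewrite (bigD1 (Ordinal hl)) //= PoszD abszE lerDl.
Qed.

(** Subtracting fewer than [n] copies of [w] adds at most a constant times [n] to each coefficient.
    Thus one range of carries serves all points of the sum and all [n]. *)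
Lemma boxes_eq_bounded W (E0 K0 : nat) : exists E K : nat, forall n p F G,
  (0 < n)%N -> (size p <= E0)%N -> (forall l, `|p`_l| <= (K0 * n)%N%:Z) ->
  (forall q, (size q <= E)%N -> (forall l, `|q`_l| <= (K * n)%N%:Z) -> F q = G q) ->
  boxes n W F p = boxes n W G p.
Proof.
elim: W E0 K0 => [|w W IH] E0 K0; first by exists E0, K0 => n p F G _ sp hp; apply.
have [k hk] := coef_bounded w.
have [E [K h]] := IH (maxn E0 (size w)) (K0 + k)%N.
exists E, K => n p F G n0 sp hp hFG; apply: eq_bigr => y _; apply: h => //.
  rewrite (leq_trans (size_polyD _ _)) // geq_max size_polyN !leq_max sp /=.
  rewrite -scaler_nat; apply/orP; right; exact: size_scale_leq.
move=> l; rewrite coefBMn; have := hp l; have := hk l.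
move: (p`_l) (w`_l) (nat_of_ord y) (ltn_ord y) => a b i; nia.
Qed.

Theorem eqp_boxes_root W p :
  eqp (fun n => boxes n W (fun q => (q.[n%:Z] == 0)%:R) p).
Proof.
have [k hk] := coef_bounded p.
have [E [K h]] := boxes_eq_bounded W (size p) k.
(* As $p-C(X-n)=(p-CX)+nC$, each carry polynomial $C$ gives a right-hand side affine in [n]. The
   threshold 2 comes from [root_carry]. *)
apply: (@eq_eqp (fun n => \sum_(c : {ffun 'I_E -> 'I_(2 * (2 * K)).+1})
   boxes n W (delta E.+1) (p - bounded_poly c * 'X + bounded_poly c *+ n)) _ 2).
  move=> n n2; symmetry.
  rewrite (h n p _ (fun q => \sum_(c : {ffun 'I_E -> 'I_(2 * (2 * K)).+1})
     delta E.+1 (q - bounded_poly c * ('X - n%:Z%:P)))) //; first last.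
  - by move=> q sq hq; apply: root_carry => //; apply: leqW.
  - move=> l; apply: le_trans (hk l) _; rewrite lez_nat; nia.
  - exact: ltnW.
  rewrite boxes_sum; apply: eq_bigr => c _; rewrite boxes_shift; congr (boxes _ _ _ _).
  by rewrite mulrBr opprB addrA addrAC (mulrC _ _%:P) mul_polyC -natz scaler_nat.
by apply: eqp_sum => c; apply: eqp_boxes.
Qed.

Fixpoint digits D p : seq {poly int} :=
  if D is D'.+1 then p :: digits D' (p * 'X) else [::].

(** At $X=n$ the multiplicities of $p,pX,\dots,pX^{D-1}$ are the base-[n] digits of one multiplicity
    of [p] below [n ^ D]. In the proof [y] is the lowest digit and [x] the number formed by the
    others. *)
Lemma boxes_digits n D p (F : int -> int) z :
  boxes n [seq q.[n%:Z] | q : {poly int} <- digits D p] F z = box (n ^ D) p.[n%:Z] F z.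
Proof.
elim: D p z => [|D IH] p z.
  by rewrite /= /box expn0 big_ord1 mulr0n subr0.
rewrite /=; transitivity (\sum_(y < n) \sum_(x < n ^ D) F (z - p.[n%:Z] *+ (x * n + y))).
  apply: eq_bigr => y _; rewrite IH; apply: eq_bigr => x _; congr F.
  by rewrite hornerMX mulrnDr opprD addrA addrAC mulnC mulrnA -[_ *+ n]mulr_natr natz.
rewrite exchange_big /= /box expnSr -(big_mkord xpredT (fun i => F (z - p.[n%:Z] *+ i))).
rewrite big_nat_mul big_mkord; apply: eq_bigr => x _.
rewrite -{2}[(x * n)%N]add0n mulSn big_addn addnK big_mkord.
by apply: eq_bigr => y _; rewrite addnC.
Qed.

Lemma boxes_cat (M : zmodType) n (V W : seq M) (F : M -> int) :
  boxes n (V ++ W) F = boxes n V (boxes n W F).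
Proof. exact: foldr_cat. Qed.

Lemma boxes_flatten_digits n D W (F : int -> int) :
  boxes n [seq q.[n%:Z] | q : {poly int} <- flatten [seq digits D p | p <- W]] F =
  boxes (n ^ D) [seq p.[n%:Z] | p : {poly int} <- W] F.
Proof.
elim: W => //= p W IH; rewrite map_cat boxes_cat IH.
by apply: funext => z; rewrite boxes_digits.
Qed.

Lemma boxes_horner k (x : int) W (F : int -> int) p :
  boxes k [seq q.[x] | q : {poly int} <- W] F p.[x] = boxes k W (fun q => F q.[x]) p.
Proof.
elim: W p => //= w W IH p; apply: eq_bigr => y _.
by rewrite -IH hornerD hornerN hornerMn.
Qed.

Theorem eqp_boxes_pow D W p :
  eqp (fun n => boxes (n ^ D) [seq q.[n%:Z] | q : {poly int} <- W]
                      (fun z => (z == 0)%:R) p.[n%:Z]).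
Proof.
apply: (@eq_eqp _ _ 0) (eqp_boxes_root (flatten [seq digits D q | q <- W]) p) => n _.
by rewrite -boxes_flatten_digits boxes_horner.
Qed.

(** * Counting solutions *)

Fixpoint sol_seq (k : nat) (V : seq int) (z : int) : seq (seq nat) :=
  if V is a :: V' then [seq y :: w | y <- iota 0 k, w <- sol_seq k V' (z - a *+ y)]
  else if z == 0 then [:: [::]] else [::].

Lemma size_sol_seq k (V : seq int) z :
  (size (sol_seq k V z))%:Z = boxes k V (fun z => (z == 0)%:R) z.
Proof.
elim: V z => [|a V IH] z /=; first by case: eqP.
rewrite size_allpairs_dep sumnE big_map (big_morph _ PoszD (erefl 0%:Z)) /box.
rewrite -(big_mkord xpredT (fun y => boxes k V (fun z => (z == 0)%:R) (z - a *+ y))).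
by rewrite /index_iota subn0; apply: eq_bigr => y _; rewrite IH.
Qed.

Lemma uniq_sol_seq k (V : seq int) z : uniq (sol_seq k V z).
Proof.
elim: V z => [|a V IH] z /=; first by case: ifP.
apply: allpairs_uniq_dep => [|y _|]; [exact: iota_uniq | exact: IH |].
by move=> [y w] [y' w'] _ _ /= [-> ->].
Qed.

Lemma mem_sol_seq k (V : seq int) z w : (w \in sol_seq k V z) =
  [&& size w == size V, all (fun y => (y < k)%N) w &
      \sum_(i < size V) nth 0 V i *+ nth 0%N w i == z].
Proof.
elim: V z w => [|a V IH] z w /=.
  rewrite big_ord0 (eq_sym 0); case: (z == 0); last by rewrite !andbF.
  by rewrite inE; case: w.
apply/allpairsPdep/idP => [[y [w' [hy hw ->]]]|].
  move: hw; rewrite IH /= eqSS => /and3P[-> -> /eqP hz] /=.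
  rewrite big_ord_recl /= hz addrC subrK eqxx.
  by move: hy; rewrite mem_iota => /andP[_ ->].
case: w => [|y w] /and3P[//]; rewrite /= eqSS => sw /andP[hy hw].
rewrite big_ord_recl /= => /eqP hz; exists y, w; split => //; first by rewrite mem_iota.
by rewrite IH sw hw -hz addrC addKr eqxx.
Qed.

Lemma denumerant_boxes s (a : 'I_s -> int) (m : int) (k : nat) :
  (forall x, denumerant_sols a m x -> forall j, x 0 j < k%:Z) ->
  denumerant_eq a m (boxes k [seq a i | i <- enum 'I_s] (fun z => (z == 0)%:R) m).
Proof.
move=> hk; set V := [seq a i | i <- enum 'I_s].
have sV : size V = s by rewrite size_map size_enum_ord.
have nV (i : 'I_s) : nth 0 V i = a i.
  by rewrite (nth_map i) ?size_enum_ord // nth_ord_enum.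
exists (size (sol_seq k V m)); split; last by rewrite size_sol_seq.
pose w (x : 'rV[int]_s) := [seq absz (x 0 i) | i <- enum 'I_s].
have sw x : size (w x) = s by rewrite size_map size_enum_ord.
have nw x (i : 'I_s) : nth 0%N (w x) i = absz (x 0 i).
  by rewrite (nth_map i) ?size_enum_ord // nth_ord_enum.
have wV x : denumerant_sols a m x -> w x \in sol_seq k V m.
  move=> hx; have [x0 xm] := hx; rewrite mem_sol_seq sw sV eqxx /=; apply/andP; split.
    by apply/allP => _ /mapP[i _ ->]; rewrite -ltz_nat gez0_abs ?x0 // hk.
  rewrite -xm; apply/eqP; apply: eq_bigr => i _.
  by rewrite nV nw -mulr_natr natz gez0_abs // mulrC.
(* A solution is sent to its position in the duplicate-free list [sol_seq]; by [hk] every solution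
   occurs there. *)
apply/card_set_bijP; exists (fun x => index (w x) (sol_seq k V m)); split.
- by move=> x hx /=; rewrite index_mem wV.
- move=> x y; rewrite !inE => hx hy hxy.
  have : w x = w y by rewrite -(nth_index [::] (wV _ hx)) hxy nth_index ?wV.
  move=> wxy; apply/rowP => i.
  by rewrite -(gez0_abs (hx.1 i)) -(gez0_abs (hy.1 i)) -!nw wxy.
move=> i /= hi; set u := nth [::] (sol_seq k V m) i.
have : u \in sol_seq k V m by apply: mem_nth.
rewrite mem_sol_seq sV => /and3P[/eqP su _ /eqP hm].
pose x : 'rV[int]_s := \row_j (nth 0%N u j)%:Z.
have wx : w x = u.
  apply: (@eq_from_nth _ 0%N) => [|j]; rewrite sw ?su // => hj.
  by rewrite (nw x (Ordinal hj)) mxE.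
exists x; last by rewrite wx index_uniq // uniq_sol_seq.
split=> [j|]; first by rewrite mxE.
by rewrite -hm; apply: eq_bigr => j _; rewrite mxE nV mulrC -mulr_natr natz.
Qed.

Lemma clear_denominators (I : finType) (a : I -> {poly rat}) :
  exists (L : int) (G : I -> {poly int}), 0 < L /\
    forall i, map_poly intr (G i) = L%:~R *: a i :> {poly rat}.
Proof.
have /choice [q /choice [d hd]] : forall i, exists q : {poly int}, exists d : int,
    d != 0 /\ a i = d%:~R^-1 *: map_poly intr q.
  by move=> i; have [q [d d0 e]] := rat_poly_scale (a i); exists q, d.
pose D := \prod_i d i.
have D0 : D != 0 by apply/prodf_neq0 => i _; case: (hd i).
(* The square makes the common factor positive whatever the signs of the [d i]. *)
exists (D ^+ 2), (fun i => (D * \prod_(j | j != i) d j) *: q i); split.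
  by rewrite lt_neqAle sqr_ge0 eq_sym sqrf_eq0 D0.
move=> i; have [d0 ->] := hd i; rewrite map_polyZ /= scalerA; congr (_ *: _).
have eD : D = d i * \prod_(j | j != i) d j by rewrite /D (bigD1 i).
set P := \prod_(j | _) _ in eD *; rewrite eD expr2 !intrM; field.
by rewrite intr_eq0.
Qed.

Lemma eventually_pos p : 0 < lead_coef p ->
  exists N : nat, forall n, (N <= n)%N -> 0 < p.[n%:Z].
Proof.
elim/poly_ind: p => [|p c IH]; first by rewrite lead_coef0.
have [->|p0] := eqVneq p 0.
  by rewrite mul0r add0r lead_coefC => c0; exists 0%N => n _; rewrite hornerC.
rewrite lead_coefDl ?lead_coefMX; last first.
  by rewrite size_mulX // size_polyC ltnS (leq_trans (leq_b1 _)) // size_poly_gt0.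
move=> /IH[N hN]; exists (maxn N (absz c).+1) => n; rewrite geq_max => /andP[/hN h1 h2].
(* A positive integer value is at least 1, so one Horner step stays positive once [n] exceeds the
   absolute value of [c]. *)
rewrite !hornerE; move: h1; move: (p.[_]) => x; nia.
Qed.

Lemma eventually_lt_pow p :
  exists D N : nat, forall n, (N <= n)%N -> p.[n%:Z] < (n ^ D)%N%:Z.
Proof.
elim/poly_ind: p => [|p c [D [N h]]].
  by exists 0%N, 0%N => n _; rewrite horner0.
exists D.+1, (maxn N (absz c).+1) => n; rewrite geq_max => /andP[/h h1 h2].
rewrite !hornerE expnS; move: h1; move: (p.[_]) (n ^ D)%N => x y; nia.
Qed.

Lemma int_funK (p : {poly rat}) n : integer_valued p -> (int_fun p n)%:~R = p.[n%:R].
Proof. by move=> /(_ n%:Z) h; rewrite /int_fun floorK. Qed.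

Lemma sols_lt (s : nat) (a : 'I_s -> int) (m : int) (k : nat) x :
  (forall i, 0 < a i) -> m < k%:Z -> denumerant_sols a m x -> forall j, x 0 j < k%:Z.
Proof.
move=> a0 mk [x0 xm] j; apply: le_lt_trans mk; rewrite -xm (bigD1 j) //=.
rewrite ler_wpDr ?sumr_ge0 // => [i _|]; first by rewrite mulr_ge0 // ltW.
by rewrite ler_peMr ?x0 // -gtz0_ge1.
Qed.

Lemma denumerant_solsM (s : nat) (a b : 'I_s -> int) (m k L : int) : L != 0 ->
  (forall i, b i = L * a i) -> k = L * m ->
  denumerant_sols b k = denumerant_sols a m.
Proof.
move=> L0 hb ->.
have E (x : 'rV[int]_s) : \sum_(j < s) x 0 j * b j = L * \sum_(j < s) x 0 j * a j.
  by rewrite mulr_sumr; apply: eq_bigr => j _; rewrite hb mulrCA.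
apply/seteqP; split=> x [x0 xm]; split=> //.
  by apply: (mulfI L0); rewrite -E.
by rewrite E xm.
Qed.

Theorem theorem1p1 (s : nat) (hs : (1 <= s)%N)
  (m : {poly rat}) (a : 'I_s -> {poly rat})
  (m_int : integer_valued m) (a_int : forall i, integer_valued (a i))
  (m_pos : 0 < lead_coef m) (a_pos : forall i, 0 < lead_coef (a i))
  (a_cop : strongly_coprime (fun i => int_fun (a i))) :
  exists (f : nat -> int) (N0 : nat),
    quasi_poly f /\
    forall n : nat, (N0 <= n)%N ->
      denumerant_eq (fun i => int_fun (a i) n) (int_fun m n) (f n).
Proof.
(* Indexing by [option] gives one factor [L] for [m], at [None], and all the [a i]. *)
have [L [G [L0 hG]]] := clear_denominators (oapp a m).
have Gn (p : {poly rat}) i n : oapp a m i = p -> integer_valued p ->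
    (G i).[n%:Z] = L * int_fun p n.
  move=> ip p_int; apply: (@intr_inj rat).
  rewrite intrM int_funK // -horner_map /= hG ip hornerZ; congr (_ * _.[_]).
pose H := G None; pose A i := G (Some i).
have A_pos i : 0 < lead_coef (A i).
  rewrite -(ltr0z rat) -(lead_coef_map_inj (@intr_inj rat) (mulr0z 1)).
  by rewrite hG lead_coefZ mulr_gt0 ?ltr0z //; apply: a_pos.
have /choice[N hN] i := eventually_pos (A_pos i).
have [D [N' hN']] := eventually_lt_pow H.
have [f [N'' [qf hf]]] := eqp_quasi_poly (eqp_boxes_pow D [seq A i | i <- enum 'I_s] H).
(* The three thresholds ensure that all [A i] are positive at [n], that [H] is below [n ^ D] there,
   and that the count equals [f]. The first two bound every entry of a solution by [n ^ D]. *)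
exists f, (maxn (\max_i N i) (maxn N' N'')); split=> // n.
rewrite !geq_max => /and3P[/bigmax_leqP nN nN' nN''].
rewrite -hf // -map_comp /denumerant_eq.
have E := @denumerant_solsM s (fun i => int_fun (a i) n) (fun i => (A i).[n%:Z])
  (int_fun m n) H.[n%:Z] L.
rewrite -E ?lt0r_neq0 //; first last.
- exact: Gn.
- by move=> i; apply: Gn.
apply: denumerant_boxes => x; apply: sols_lt => [i|]; last exact: hN'.
by apply: hN; apply: nN.
Qed.
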